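(* Let $r\ge 1$. (i) Let $M=(M_1,\ldots,M_r)$ be a tuple of $0$-$1$-matrices over a finite alphabet $B$ satisfying the Robertson–Steger conditions (H0)–(H3) listed in the context, let $(X_M,d)$ be the associated rank-$r$ subshift of finite type with shifts $T^p$, $p\in\mathbb{Z}_+^r$. Then for every $p=(p_1,\ldots,p_r)\in\mathbb{Z}_+^r$ the topological entropy of the continuous map $T^p:X_M\to X_M$ equals $$\log \mathrm{r}\big(M_1^{p_1}M_2^{p_2}\cdots M_r^{p_r}\big),$$ where $\mathrm{r}$ denotes the spectral radius. (ii) If $r\geq 2$, $\Lambda$ is a row finite rank-$r$ graph with no sources and with a finite set of objects, and $X=\Lambda^\infty$ is the associated rank-$r$ subshift, then the topological entropy of the action of $\mathbb{Z}_+^r$ on $X$ by the shifts $(T^p)_{p\in\mathbb{Z}_+^r}$ is equal to $0$.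
   Context: Orders on $\mathbb{Z}_+^r$ ($\mathbb{Z}_+=\{0,1,2,\ldots\}$) are coordinatewise; $e_1,\dots,e_r$ is the standard basis; $[m,n]=\{l\in\mathbb{Z}_+^r: m\le l\le n\}$; for $j\in\mathbb{Z}_+$, $\bar j=(j,\ldots,j)$. Rank-$r$ graphs. A rank-$r$ graph $\Lambda$ is a small category with set of objects $\Lambda^0$ (identified with the morphisms of shape $0$), with origin and terminal maps $o,t:\Lambda\to\Lambda^0$ on morphisms (''words''), the product $uv$ being defined when $t(u)=o(v)$ (with $o(uv)=o(u)$, $t(uv)=t(v)$), together with a shape functor $\sigma$ from $\Lambda$ to the one-object category with morphisms $\mathbb{Z}_+^r$ (so $\sigma(uv)=\sigma(u)+\sigma(v)$), satisfying the factorisation property: every $w$ with $\sigma(w)=m+n$ is a unique product $w=uv$ with $\sigma(u)=m$, $\sigma(v)=n$, $t(u)=o(v)$. Put $\Lambda_m=\{w\in\Lambda:\sigma(w)=m\}$ and $\Lambda_m(\lambda)=\{w\in\Lambda_m:o(w)=\lambda\}$. $\Lambda$ is row finite if all $\Lambda_m(\lambda)$ are finite and has no sources if all $\Lambda_m(\lambda)$ are nonempty ($m\in\mathbb{Z}_+^r$, $\lambda\in\Lambda^0$). Path space and shifts. $\Lambda^\infty$ is the set of families $x=(x_{(m,n)})_{m\le n}$ ($m,n\in\mathbb{Z}_+^r$) with $x_{(m,n)}\in\Lambda_{n-m}$ and $x_{(m,n)}=x_{(m,k)}x_{(k,n)}$ for all $m\le k\le n$. Write $x|_{m]}=x_{(0,m)}$.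 The topology is generated by the cylinder sets $Z_u=\{x: x_{(0,\sigma(u))}=u\}$, $u\in\Lambda$, and is induced by the metric $d(x,x)=0$, $d(x,y)=\frac1{k+1}$ for $x\ne y$, where $k=\min\{j\in\mathbb{Z}_+: x|_{\bar j]}\neq y|_{\bar j]}\}$; $\Lambda^\infty$ is a compact metric space. For $p\in\mathbb{Z}_+^r$ the shift is $T^p(x)_{(m,n)}=x_{(m+p,n+p)}$. The space $(\Lambda^\infty,d)$ with the action $T$ of $\mathbb{Z}_+^r$ is called a rank-$r$ subshift. Subshifts of finite type. Let $B$ be a finite alphabet and $M_1,\ldots,M_r:B\times B\to\{0,1\}$ matrices. For $m\in\mathbb{Z}_+^r$ let $W_m$ be the set of maps $w:[0,m]\to B$ such that $M_j(w(l),w(l+e_j))=1$ whenever $l,l+e_j\in[0,m]$; $W=\bigcup_m W_m$, $\sigma(w)=m$ for $w\in W_m$, $o(w)=w(0)$, $t(w)=w(\sigma(w))$. The conditions are: (H0) each $M_j$ is a nonzero $\{0,1\}$-matrix; (H1) if $u\in W_m$, $v\in W_n$ and $t(u)=o(v)$, there is a unique $w\in W_{m+n}$ with $w|_{[0,m]}=u$ and $w(m+l)=v(l)$ for $l\in[0,n]$ (this $w$ is the product $uv$); (H2) the directed graph with vertex set $B$ and an edge from $a$ to $b$ for each $j$ with $M_j(a,b)=1$ is irreducible (any vertex can be reached from any other by a directed path); (H3) for every nonzero $p\in\mathbb{Z}^r$ there is $w\in W$ which is not $p$-periodic, where $w\in W_m$ is $p$-periodic if $w(l)=w(l-p)$ whenever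 both $l$ and $l-p$ lie in $[0,m]$. Then $W$ is a rank-$r$ graph (with $\Lambda=W$, $\Lambda^0=B$), and $W^\infty$ is identified with $X_M=\{x:\mathbb{Z}_+^r\to B:\ M_j(x(m),x(m+e_j))=1\ \forall m\in\mathbb{Z}_+^r,\ j=1,\ldots,r\}$, with $(T^px)(m)=x(m+p)$. $(X_M,d)$ with $T$ is the rank-$r$ subshift of finite type given by $M$. Entropy. The topological entropy of a single continuous map is the usual (Bowen) one. For the action of $\mathbb{Z}_+^r$: let $C_n=\{a\in\mathbb{Z}_+^r:\max_i a_i\le n\}$, let $s(n,\varepsilon)$ be the maximal cardinality of a set $E\subseteq X$ such that $\max_{a\in C_n}d(T^ax,T^ay)>\varepsilon$ for all distinct $x,y\in E$; the topological entropy of the action is $\sup_{\varepsilon>0}\limsup_{n\to\infty}\frac1{n^r}\log s(n,\varepsilon)$. *)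

(* Defs.v *)
From HB Require Import structures.
From mathcomp Require Import all_boot all_order all_algebra finmap complex.
From mathcomp Require Import all_classical all_reals all_analysis.

Set Implicit Arguments.
Unset Strict Implicit.
Unset Printing Implicit Defensive.

Import Order.TTheory GRing.Theory Num.Theory.
Import numFieldNormedType.Exports.

Local Open Scope classical_set_scope.
Local Open Scope ring_scope.

(** * Multi-indices *)

(* Addition and zero on [multi r] are the pointwise ones of the library. *)
Notation multi r := {ffun 'I_r -> nat}.

Section Multi.
Variable r : nat.
Implicit Types m n p : multi r.

Definition mle m n : bool := [forall i, (m i <= n i)%N].

Definition unitm (j : 'I_r) : multi r := [ffun i => (i == j : nat)].

Definition diag (j : nat) : multi r := [ffun => j].

(* Only used for [mle m n]; the coordinatewise subtraction truncates. *)
Definition subm n m : multi r := [ffun i => (n i - m i)%N].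

Lemma mle0m m : mle 0 m.
Proof. by apply/forallP => i; rewrite ffunE. Qed.

Lemma mle_refl m : mle m m.
Proof. exact/forallP. Qed.

Lemma mle_trans m n p : mle m n -> mle n p -> mle m p.
Proof.
move=> /forallP mn /forallP np.
by apply/forallP => i; apply: leq_trans (mn i) (np i).
Qed.

Lemma mle_add m n p : mle m n -> mle (m + p) (n + p).
Proof.
by move=> /forallP mn; apply/forallP => i; rewrite !ffunE leq_add2r.
Qed.

Lemma subm_add m n p : subm (n + p) (m + p) = subm n m.
Proof. by apply/ffunP => i; rewrite !ffunE subnDr. Qed.

Lemma subm0 m : subm m 0 = m.
Proof. by apply/ffunP => i; rewrite !ffunE subn0. Qed.

Lemma submD m n p : mle m n -> mle n p -> subm p m = subm n m + subm p n.
Proof.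
move=> /forallP mn /forallP np; apply/ffunP => i.
rewrite !ffunE addrC -[RHS]/((p i - n i) + (n i - m i))%N.
by rewrite addnBA ?subnK.
Qed.

Lemma mle_diag m : mle m (diag (\max_i m i)%N).
Proof. by apply/forallP => i; rewrite ffunE leq_bigmax. Qed.

End Multi.

(** * The metric determined by a sequence of restriction maps *)

(* [1 / (k + 1)] where [k] is the least index with different restrictions;
   if there is no such index then [x = y] in both uses below. *)
Definition first_diff_dist (R : realType) (X : Type) (Y : nat -> Type)
    (res : forall j, X -> Y j) (x y : X) : R :=
  match pselect (exists j, `[< res j x <> res j y >]) with
  | left h => (ex_minn h).+1%:R^-1
  | right _ => 0
  end.

Section FirstDiff.
Variables (R : realType) (X : Type) (Y : nat -> Type).
Variable res : forall j, X -> Y j.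
Local Notation d := (@first_diff_dist R X Y res).

Lemma first_diff_distxx x : d x x = 0.
Proof.
rewrite /first_diff_dist; case: pselect => // h; exfalso.
by case: h => j /asboolP.
Qed.

Lemma first_diff_dist_eq0 x y : d x y = 0 -> forall j, res j x = res j y.
Proof.
rewrite /first_diff_dist; case: pselect => [h /eqP|h _ j].
  by rewrite invr_eq0 pnatr_eq0.
by apply: contrapT => xy; apply: h; exists j; apply/asboolP.
Qed.

Lemma first_diff_dist_sym x y : d x y = d y x.
Proof.
have E j : `[< res j x <> res j y >] = `[< res j y <> res j x >].
  by apply: asbool_equiv_eq; split; exact: nesym.
rewrite /first_diff_dist; case: pselect => h; case: pselect => h' //.
- congr (_.+1%:R^-1); apply: eq_ex_minn => j; exact: E.
- by case: h' ; case: h => j; exists j; rewrite -E.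
- by case: h ; case: h' => j; exists j; rewrite E.
Qed.

Lemma first_diff_dist_ge0 x y : 0 <= d x y.
Proof. by rewrite /first_diff_dist; case: pselect. Qed.

Lemma first_diff_dist_lb x y j : res j x <> res j y -> j.+1%:R^-1 <= d x y.
Proof.
move=> /asboolP xy; rewrite /first_diff_dist.
case: pselect => [h|[]]; last by exists j.
case: ex_minnP => k _ /(_ _ xy) kj.
by rewrite lef_pV2 ?posrE ?ltr0n// ler_nat.
Qed.

Lemma first_diff_dist_triangle y x z : d x z <= d x y + d y z.
Proof.
rewrite {1}/first_diff_dist; case: pselect => [h|_]; last first.
  by rewrite addr_ge0 ?first_diff_dist_ge0.
case: ex_minnP => k /asboolP xz _.
have [xy|xy] := pselect (res k x = res k y).
  rewrite -[leLHS]add0r lerD ?first_diff_dist_ge0//.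
  by apply: first_diff_dist_lb; rewrite -xy.
rewrite -[leLHS]addr0 lerD ?first_diff_dist_ge0//.
exact: first_diff_dist_lb.
Qed.

End FirstDiff.

(** * Topological entropy *)

Section Entropy.
Variables (R : realType) (X : metricType R).

Definition eps_separated (D : X -> X -> R) (eps : R) (E : {fset X}) : Prop :=
  forall x y, x \in E -> y \in E -> x != y -> eps < D x y.

Definition max_separated (D : X -> X -> R) (eps : R) : \bar R :=
  ereal_sup [set (#|` E|%:R)%:E | E in [set E | eps_separated D eps E]].

(* The maximum with [1] matters only when [X] is empty: the entropy of the
   empty space is [0] by convention. *)
Definition log_max_separated (D : X -> X -> R) (eps : R) : \bar R :=
  lne (maxe 1%E (max_separated D eps)).

Definition bowen_dist (f : X -> X) (n : nat) (x y : X) : R :=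
  \big[Num.max/0]_(i < n) mdist (iter i f x) (iter i f y).

Definition entropy (f : X -> X) : \bar R :=
  ereal_sup [set limn_esup (fun n : nat =>
      ((n%:R^-1)%:E * log_max_separated (bowen_dist f n) eps)%E)
    | eps in [set eps : R | 0 < eps]].

(* The index [a] runs over the multi-indices with all coordinates [<= n]. *)
Definition action_dist (r : nat) (T : multi r -> X -> X) (n : nat) (x y : X)
    : R :=
  \big[Num.max/0]_(a : {ffun 'I_r -> 'I_n.+1})
    mdist (T [ffun i => a i : nat] x) (T [ffun i => a i : nat] y).

Definition action_entropy (r : nat) (T : multi r -> X -> X) : \bar R :=
  ereal_sup [set limn_esup (fun n : nat =>
      (((n ^ r)%:R^-1)%:E * log_max_separated (action_dist T n) eps)%E)
    | eps in [set eps : R | 0 < eps]].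

End Entropy.

(** * Spectral radius *)

Definition spectral_radius (R : realType) (n : nat) (A : 'M[R[i]]_n) : R :=
  sup [set ComplexField.Normc.normc l | l in [set l : R[i] | eigenvalue A l]].

(** * Rank-r graphs *)

(* [mulw u v] is meaningful only when [tgt u = org v]. *)
Record rank_graph (r : nat) := RankGraph {
  obj : Type;
  word : Type;
  org : word -> obj;
  tgt : word -> obj;
  idw : obj -> word;
  mulw : word -> word -> word;
  shapew : word -> multi r;
  org_id : forall a, org (idw a) = a;
  tgt_id : forall a, tgt (idw a) = a;
  org_mulw : forall u v, tgt u = org v -> org (mulw u v) = org u;
  tgt_mulw : forall u v, tgt u = org v -> tgt (mulw u v) = tgt v;
  mul1w : forall u, mulw (idw (org u)) u = u;
  mulw1 : forall u, mulw u (idw (tgt u)) = u;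
  mulwA : forall u v w, tgt u = org v -> tgt v = org w ->
    mulw u (mulw v w) = mulw (mulw u v) w;
  shapew_id : forall a, shapew (idw a) = 0;
  shapew_mul : forall u v, tgt u = org v ->
    shapew (mulw u v) = shapew u + shapew v;
  factorisation : forall w m n, shapew w = m + n ->
    exists! uv : word * word,
      [/\ shapew uv.1 = m, shapew uv.2 = n, tgt uv.1 = org uv.2
        & w = mulw uv.1 uv.2]
}.

Section RankGraph.
Variables (r : nat) (L : rank_graph r).

Definition words_from (m : multi r) (a : obj L) : set (word L) :=
  [set w | shapew w = m /\ org w = a].

Definition row_finite : Prop := forall m a, finite_set (words_from m a).

Definition no_sources : Prop := forall m a, words_from m a !=set0.

Definition is_path (x : forall m n : multi r, mle m n -> word L) : Prop :=
  (forall m n (mn : mle m n), shapew (x m n mn) = subm n m) /\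
  (forall m k n (mk : mle m k) (kn : mle k n) (mn : mle m n),
    tgt (x m k mk) = org (x k n kn) /\
    x m n mn = mulw (x m k mk) (x k n kn)).

(* The dummy argument [R] fixes the field in which distances are taken. *)
Record path_space (R : realType) := PathSpace {
  path_word :> forall m n : multi r, mle m n -> word L;
  path_wordP : is_path path_word
}.

End RankGraph.

Section PathSpace.
Variables (r : nat) (L : rank_graph r) (R : realType).
Local Notation X := (path_space L R).

Lemma path_space_ext (x y : X) :
  (forall m n (mn : mle m n), x m n mn = y m n mn) -> x = y.
Proof.
case: x y => [x xP] [y yP] /= xy.
have {}xy : x = y.
  by apply: functional_extensionality_dep => m;
     apply: functional_extensionality_dep => n;
     apply: functional_extensionality_dep => mn; exact: xy.
by case: _ / xy yP => yP; congr PathSpace; exact: Prop_irrelevance.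
Qed.

Definition path_prefix (m : multi r) (x : X) : word L := x 0 m (mle0m m).

Lemma mulw_inj (u u' v v' : word L) : tgt u = org v -> tgt u' = org v' ->
  shapew u = shapew u' -> shapew v = shapew v' -> mulw u v = mulw u' v' ->
  u = u' /\ v = v'.
Proof.
move=> uv uv' su sv E.
have [[a b] [_ ab]] := factorisation (shapew_mul uv).
have e1 := ab (u, v) (And4 erefl erefl uv erefl).
have e2 := ab (u', v') (And4 (esym su) (esym sv) uv' E).
by move: e1; rewrite e2 => -[-> ->].
Qed.

Lemma path_prefix_separates (x y : X) :
  (forall j, path_prefix (diag r j) x = path_prefix (diag r j) y) -> x = y.
Proof.
move=> xy; apply: path_space_ext => m n mn.
set N := diag r (\max_i n i)%N; have nN : mle n N := mle_diag n.
have mN := mle_trans mn nN.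
have [xs xm] := path_wordP x; have [ys ym] := path_wordP y.
have [xt1 x1] := xm _ _ _ (mle0m m) mN (mle0m N).
have [yt1 y1] := ym _ _ _ (mle0m m) mN (mle0m N).
have [xt2 x2] := xm _ _ _ mn nN mN.
have [yt2 y2] := ym _ _ _ mn nN mN.
have [_ e] : x 0 m (mle0m m) = y 0 m (mle0m m) /\ x m N mN = y m N mN.
  apply: mulw_inj => //; rewrite ?xs ?ys//.
  by rewrite -x1 -y1; exact: xy.
have [] // : x m n mn = y m n mn /\ x n N nN = y n N nN.
by apply: mulw_inj => //; rewrite ?xs ?ys// -x2 -y2.
Qed.

Definition path_dist : X -> X -> R :=
  first_diff_dist R (fun j => path_prefix (diag r j)).

Lemma path_dist_positivity x y : path_dist x y = 0 -> x = y.
Proof. move=> xy; apply: path_prefix_separates; exact: first_diff_dist_eq0 xy. Qed.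

HB.instance Definition _ := gen_eqMixin X.
HB.instance Definition _ := gen_choiceMixin X.
HB.instance Definition _ := @isMetric.Build R X path_dist
  (@first_diff_distxx _ _ _ _) path_dist_positivity
  (@first_diff_dist_sym _ _ _ _) (@first_diff_dist_triangle _ _ _ _).

Lemma path_shift_is_path (p : multi r) (x : X) :
  is_path (fun m n mn => x (m + p) (n + p) (mle_add p mn)).
Proof.
have [xs xm] := path_wordP x.
by split=> [m n mn|m k n mk kn mn]; [rewrite xs subm_add | exact: xm].
Qed.

Definition path_shift (p : multi r) (x : X) : X :=
  PathSpace R (path_shift_is_path p x).

End PathSpace.

(** * Subshifts of finite type *)

Section SFT.
Variables (r : nat) (B : finType).

(* A 0-1 matrix indexed by [B] is a boolean relation on [B]. *)
Variable M : 'I_r -> rel B.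

Definition box (m : multi r) : Type := {l : multi r | mle l m}.

Definition is_word (m : multi r) (w : box m -> B) : Prop :=
  forall (j : 'I_r) (l k : box m),
    sval k = sval l + unitm j -> M j (w l) (w k).

Definition word_org (m : multi r) (w : box m -> B) : B :=
  w (exist _ 0 (mle0m m)).

Definition word_tgt (m : multi r) (w : box m -> B) : B :=
  w (exist _ m (mle_refl m)).

Definition cond_H0 : Prop := forall j, exists a b, M j a b.

Definition is_product (m n : multi r) (u : box m -> B) (v : box n -> B)
    (w : box (m + n) -> B) : Prop :=
  (forall (l : box m) (k : box (m + n)), sval k = sval l -> w k = u l) /\
  (forall (l : box n) (k : box (m + n)), sval k = m + sval l -> w k = v l).

Definition cond_H1 : Prop :=
  forall (m n : multi r) (u : box m -> B) (v : box n -> B),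
    is_word u -> is_word v -> word_tgt u = word_org v ->
    exists! w : box (m + n) -> B, is_word w /\ is_product u v w.

Definition cond_H2 : Prop :=
  forall a b, connect (fun c d => [exists j, M j c d]) a b.

Definition p_periodic (p : {ffun 'I_r -> int}) (m : multi r) (w : box m -> B)
    : Prop :=
  forall l k : box m,
    (forall i, (sval k i)%:Z = (sval l i)%:Z - p i) -> w l = w k.

Definition cond_H3 : Prop :=
  forall p : {ffun 'I_r -> int}, p != 0 ->
    exists (m : multi r) (w : box m -> B), is_word w /\ ~ p_periodic p w.

Definition is_sft_point (x : multi r -> B) : Prop :=
  forall (m : multi r) (j : 'I_r), M j (x m) (x (m + unitm j)).

(* The dummy argument [R] fixes the field in which distances are taken. *)
Record sft (R : realType) := Sft {
  sft_fun :> multi r -> B;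
  sft_funP : is_sft_point sft_fun
}.

Definition sft_matrix (R : realType) (j : 'I_r) : 'M[R[i]]_#|B| :=
  \matrix_(a, b) (M j (enum_val a) (enum_val b))%:R.

Section Metric.
Variable R : realType.
Local Notation X := (sft R).

Definition sft_restr (m : multi r) (x : X) : box m -> B := x \o sval.
Arguments sft_restr m x : clear implicits.

Lemma sft_restr_separates (x y : X) :
  (forall j, sft_restr (diag r j) x = sft_restr (diag r j) y) -> x = y.
Proof.
move=> H; have {H} : (x : _ -> _) = y.
  apply/funext => m.
  exact: (congr1 (fun f => f (exist _ m (mle_diag m))) (H _)).
case: x y => [x xP] [y yP] /= xy.
by case: _ / xy yP => yP; congr Sft; exact: Prop_irrelevance.
Qed.

Definition sft_dist : X -> X -> R :=
  first_diff_dist R (fun j => sft_restr (diag r j)).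

Lemma sft_dist_positivity x y : sft_dist x y = 0 -> x = y.
Proof. move=> xy; apply: sft_restr_separates; exact: first_diff_dist_eq0 xy. Qed.

HB.instance Definition _ := gen_eqMixin X.
HB.instance Definition _ := gen_choiceMixin X.
HB.instance Definition _ := @isMetric.Build R X sft_dist
  (@first_diff_distxx _ _ _ _) sft_dist_positivity
  (@first_diff_dist_sym _ _ _ _) (@first_diff_dist_triangle _ _ _ _).

Lemma sft_shift_is_sft_point (p : multi r) (x : X) :
  is_sft_point (fun m => x (m + p)).
Proof. by move=> m j; rewrite addrAC; exact: sft_funP. Qed.

Definition sft_shift (p : multi r) (x : X) : X :=
  Sft R (sft_shift_is_sft_point p x).

End Metric.
End SFT.

(* Main.v *)
Require Import Defs.
From mathcomp Require Import all_boot all_order all_algebra finmap complex.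
From mathcomp Require Import all_classical all_reals all_analysis.

Set Implicit Arguments.
Unset Strict Implicit.
Unset Printing Implicit Defensive.

Import Order.TTheory GRing.Theory Num.Theory.
Import numFieldNormedType.Exports.
Import ComplexField.

Local Open Scope classical_set_scope.
Local Open Scope ring_scope.

(** (i) By (H1) a word of shape [m] is the same as a labelling of the vertices
    of one fixed staircase from [0] to [m] compatible with the [M_j], so there
    are as many words of shape [n p + k] as the entries of [A ^ n M^k] sum up
    to, where [A = M_1^p_1 ... M_r^p_r]; (H0)-(H2) let every word be extended
    to a point.  Orbit segments of length [n] under [T^p] that are separated at
    scale [1 / (k + 1)] have different words of shape [n p + k], and when [k]
    is at least every [p_i] different words of shape [n p] give separated
    segments.  The entries of [A ^ n] grow like the [n]-th power of the spectral
    radius.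

    (ii) A word of shape [(K, ..., K)] is a product of [K] words of shape
    [(1, ..., 1)], so the logarithm of the number of separated points grows at
    most linearly in [n], and [n = o(n^r)] for [r >= 2]. *)

(** * Growth of matrix powers *)

(** With [D = a 0 + C / (rho - l)] one has [l * D + C <= rho * D], because [(rho - l) * D >= C]; so
    the bound [D * rho ^+ k] passes through the recurrence. *)
Lemma affine_recurrence_bound (F : numFieldType) (a : nat -> F) (l C rho : F) :
  0 <= l -> l < rho -> 0 <= C -> 0 <= a 0 ->
  (forall k, a k.+1 <= l * a k + C * rho ^+ k) ->
  forall k, a k <= (a 0 + C / (rho - l)) * rho ^+ k.
Proof.
move=> l0 lr C0 a0 H; have rho0 : 0 < rho by apply: le_lt_trans lr.
have d0 : 0 < rho - l by rewrite subr_gt0.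
elim=> [|k IH]; first by rewrite expr0 mulr1 lerDl divr_ge0 // ltW.
apply: le_trans (H k) _.
have h : l * a k <= l * ((a 0 + C / (rho - l)) * rho ^+ k) by rewrite ler_wpM2l.
apply: (le_trans (lerD h (lexx _))).
rewrite exprS mulrA mulrA -mulrDl ler_wpM2r ?exprn_ge0 ?(ltW rho0) //.
rewrite -lerBrDl [_ * rho]mulrC -mulrBl mulrDr [X in _ + X]mulrC divfK ?gt_eqF //.
by rewrite lerDr mulr_ge0 // ltW.
Qed.

(* Peeling off one factor [A - l] of an annihilating polynomial turns the
   growth of [A ^+ k * Y] into a first-order linear recurrence. *)
Lemma power_growth_annihilated (F : numFieldType) n (A : 'M[F]_n.+1) (rho : F)
    (s : seq F) (Y : 'M[F]_n.+1) :
  0 < rho -> {in s, forall l, `|l| < rho} ->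
  horner_mx A (\prod_(l <- s) ('X - l%:P)) * Y = 0 ->
  exists2 C, 0 <= C & forall k i j, `|(A ^+ k * Y) i j| <= C * rho ^+ k.
Proof.
move=> rho0; elim: s Y => [|l s IH] Y ls.
  rewrite big_nil rmorph1 mul1r => ->; exists 0 => // k i j.
  by rewrite mulr0 mxE normr0 mul0r.
rewrite big_cons mulrC rmorphM -mulrA rmorphB /= horner_mx_X horner_mx_C.
case/IH => [l' l's|C C0 HC]; first by rewrite ls // inE l's orbT.
have lrho : `|l| < rho by rewrite ls // inE eqxx.
have lrho' : 0 < rho - `|l| by rewrite subr_gt0.
(* The sum of all entries of [Y] dominates each initial value, so one constant serves every
   entry. *)
exists ((\sum_i \sum_j `|Y i j|) + C / (rho - `|l|)) => [|k i j].
  rewrite addr_ge0 ?divr_ge0 ?(ltW lrho') //.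
  by apply: sumr_ge0 => i _; apply: sumr_ge0.
have := @affine_recurrence_bound _ (fun k => `|(A ^+ k * Y) i j|) _ _ _
  (normr_ge0 l) lrho C0 (normr_ge0 _) _ k.
move=> /(_ _)/le_trans; apply=> //=.
(* Writing [A = (A - l) + l] leaves [l] times the previous term plus the entry of
   [A ^+ k * ((A - l) * Y)], which the induction hypothesis bounds. *)
- move=> {}k; rewrite exprSr -mulrA -[A in A * Y](subrK l%:M) mulrDl mulrDr.
  rewrite mxE addrC -mulmxE mul_scalar_mx -scalemxAr mulmxE mxE.
  by apply: (le_trans (ler_normD _ _)); rewrite normrM lerD.
- rewrite expr0 mul1r ler_wpM2r ?exprn_ge0 ?(ltW rho0) // lerD //.
  rewrite (bigD1 i) //= (bigD1 j) //= -addrA lerDl addr_ge0 ?sumr_ge0 //.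
  by move=> i' _; apply: sumr_ge0.
Qed.

(** Over a closed field the characteristic polynomial splits, its roots are the eigenvalues, and by
    Cayley-Hamilton it annihilates [A]. *)
Lemma power_growth (F : numClosedFieldType) n (A Y : 'M[F]_n) (rho : F) :
  0 < rho -> (forall l, eigenvalue A l -> `|l| < rho) ->
  exists2 C, 0 <= C & forall k i j, `|(A ^+ k * Y) i j| <= C * rho ^+ k.
Proof.
case: n A Y => [|n] A Y rho0 eA; first by exists 0 => // k [].
have [s Es] := closed_field_poly_normal (char_poly A).
move: Es; rewrite (monicP (char_poly_monic A)) scale1r => Es.
apply: (@power_growth_annihilated F n A rho s) => // [l ls|].
  by apply: eA; rewrite eigenvalue_root_char Es root_prod_XsubC.
by rewrite -Es Cayley_Hamilton mul0r.
Qed.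

Lemma eigenvalue_exists (F : closedFieldType) n (A : 'M[F]_n) :
  (0 < n)%N -> exists l, eigenvalue A l.
Proof.
move=> n0; have /closed_rootP[l hl] : size (char_poly A) != 1%N.
  by rewrite size_char_poly -lt0n in n0 *; case: n n0 A.
by exists l; rewrite eigenvalue_root_char.
Qed.

(** A row eigenvector [v] satisfies [v A^k = l^k v]. Comparing sums of absolute values of
    coordinates on both sides and dividing by that of [v] gives the bound. *)
Lemma eigenvalue_power_le (F : numFieldType) n (A : 'M[F]_n) (l : F) k :
  eigenvalue A l -> `|l| ^+ k <= \sum_i \sum_j `|(A ^+ k) i j|.
Proof.
case/eigenvalueP => v vA v0.
have vAk : v *m A ^+ k = l ^+ k *: v.
  elim: k => [|k IH]; first by rewrite !expr0 scale1r mulmx1.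
  by rewrite exprSr -mulmxE mulmxA IH -scalemxAl vA scalerA exprSr.
have S0 : 0 < \sum_j `|v 0 j|.
  rewrite lt_def sumr_ge0 // andbT psumr_eq0 //; apply: contra v0.
  move=> /allP h; apply/eqP/rowP => j; rewrite mxE; apply/eqP.
  by rewrite -normr_eq0; apply: h; rewrite mem_index_enum.
rewrite -(ler_pM2r S0).
have -> : `|l| ^+ k * \sum_j `|v 0 j| = \sum_j `|\sum_i v 0 i * (A ^+ k) i j|.
  rewrite mulr_sumr; apply: eq_bigr => j _.
  by move/rowP/(_ j): vAk; rewrite !mxE => ->; rewrite normrM normrX.
apply: (@le_trans _ _ (\sum_j \sum_i `|(A ^+ k) i j| * `|v 0 i|)).
  apply: ler_sum => j _; apply: le_trans (ler_norm_sum _ _ _) _.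
  by apply: ler_sum => i _; rewrite normrM mulrC.
rewrite exchange_big /= mulr_suml; apply: ler_sum => i _.
rewrite -mulr_suml ler_wpM2l ?sumr_ge0 // (bigD1 i) //= lerDl.
exact: sumr_ge0.
Qed.

Lemma exists_seq_max (R : realDomainType) (T : eqType) (f : T -> R) (s : seq T) :
  s != [::] -> exists2 x, x \in s & {in s, forall y, f y <= f x}.
Proof.
elim: s => // a [|b s] IH _.
  by exists a; rewrite ?mem_head // => y /[!inE]/eqP->.
have [//|x xs H] := IH; have [ax|xa] := leP (f a) (f x).
  exists x; first by rewrite inE xs orbT.
  by move=> y; rewrite inE => /predU1P[->//|/H].
exists a; rewrite ?mem_head // => y; rewrite inE => /predU1P[->//|/H yx].
exact: le_trans yx (ltW xa).
Qed.

(** The eigenvalues form the finite list of roots of the characteristic polynomial, nonempty as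
    [0 < n], so the supremum is a maximum. *)
Lemma spectral_radius_attained (R : realType) n (A : 'M[R[i]]_n) :
  (0 < n)%N -> exists l, [/\ eigenvalue A l, spectral_radius A = Normc.normc l
    & forall l', eigenvalue A l' -> Normc.normc l' <= Normc.normc l].
Proof.
move=> n0.
have [s Es] := closed_field_poly_normal (char_poly A).
move: Es; rewrite (monicP (char_poly_monic A)) scale1r => Es.
have eigE l : eigenvalue A l = (l \in s).
  by rewrite eigenvalue_root_char Es root_prod_XsubC.
have s0 : s != [::].
  have [l] := eigenvalue_exists A n0; rewrite eigE.
  by apply: contraTneq => ->.
have [l ls lmax] := exists_seq_max (@Normc.normc R) s0.
have eAl : eigenvalue A l by rewrite eigE.
have lub l' : eigenvalue A l' -> Normc.normc l' <= Normc.normc l.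
  by rewrite eigE => /lmax.
exists l; split=> //.
apply/eqP; rewrite eq_le; apply/andP; split.
  apply: ge_sup; first by exists (Normc.normc l), l.
  by move=> _ [l' /lub + <-].
apply: ub_le_sup; last by exists l.
by exists (Normc.normc l) => _ [l' /lub + <-].
Qed.

Lemma spectral_radius_power_le (R : realType) n (A : 'M[R[i]]_n) k :
  (0 < n)%N ->
  ((spectral_radius A) ^+ k)%:C%C <= \sum_i \sum_j `|(A ^+ k) i j|.
Proof.
move=> /(spectral_radius_attained A)[l [eA -> _]].
rewrite rmorphXn /=; exact: (eigenvalue_power_le k eA).
Qed.

Lemma spectral_radius_growth (R : realType) n (A Y : 'M[R[i]]_n) (rho : R) :
  (0 < n)%N -> spectral_radius A < rho ->
  exists2 C, 0 <= C & forall k i j, `|(A ^+ k * Y) i j| <= (C * rho ^+ k)%:C%C.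
Proof.
move=> n0; have [l0 [_ -> lmax]] := spectral_radius_attained A n0 => lrho.
have rho0 : 0 < rho by apply: le_lt_trans lrho; case: (l0) => a b; exact: sqrtr_ge0.
have [||C C0 H] := @power_growth _ n A Y rho%:C%C.
- by rewrite ltcR.
- move=> l /lmax h; apply: (@le_lt_trans _ _ (Normc.normc l)%:C%C) => //.
  by rewrite ltcR; exact: le_lt_trans lrho.
- move: C0 H; rewrite lecE /= => /andP[/eqP C1 C0] H.
  (* [0 <= C] in the complex order forces [C] to be real, so its real part loses nothing. *)
  exists (complex.Re C) => // k i j.
  apply: le_trans (H k i j) _.
  by rewrite rmorphM rmorphXn /= -complexr0; case: C C1 {C0 H} => a b /= ->.
Qed.

(** * Staircases *)

Section MultiIndex.
Variable r : nat.
Implicit Types (m n l : multi r) (s : seq 'I_r).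

Lemma mleP m n : reflect (forall i, (m i <= n i)%N) (mle m n).
Proof. exact: forallP. Qed.

Lemma multiD m n i : (m + n) i = (m i + n i)%N.
Proof. by rewrite ffunE. Qed.

Lemma mle_addl m n : mle m (n + m).
Proof. by apply/mleP => i; rewrite ffunE leq_addl. Qed.

Lemma mle_addr m n : mle m (m + n).
Proof. by rewrite addrC mle_addl. Qed.

Lemma mle_add2l p m n : mle (p + m) (p + n) = mle m n.
Proof. by apply/mleP/mleP => h i; move: (h i); rewrite !ffunE leq_add2l. Qed.

Lemma mle_unitm j l : mle l (unitm j) -> l = 0 \/ l = unitm j.
Proof.
move=> /mleP h.
have h0 i : i != j -> l i = 0%N.
  by move=> ij; move: (h i); rewrite ffunE (negPf ij) leqn0 => /eqP.
have [lj|lj] := eqVneq (l j) 0%N; [left|right]; apply/ffunP => i; rewrite ffunE;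
  have [->|ij] := eqVneq i j; rewrite ?(h0 i) //.
by move: (h j) lj; rewrite ffunE eqxx; case: (l j) => [|[|]].
Qed.

Lemma mle_addr_unitm (i j : 'I_r) l :
  mle (l + unitm i) (unitm j) -> l = 0 /\ i = j.
Proof.
move=> /mleP h; have ij : i = j.
  by move: (h i); rewrite multiD !ffunE eqxx addn1; case: eqP.
split=> //; apply/ffunP => k; move: (h k); rewrite ij multiD !ffunE.
by rewrite -{2}[nat_of_bool _]add0n leq_add2r leqn0 => /eqP.
Qed.

Lemma diagS k : diag r k.+1 = diag r k + diag r 1.
Proof. by apply/ffunP => i; rewrite multiD !ffunE addn1. Qed.

Lemma diag_mono (j k : nat) : (j <= k)%N -> mle (diag r j) (diag r k).
Proof. by move=> jk; apply/mleP => i; rewrite !ffunE. Qed.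

Definition staircase_end s : multi r := \sum_(j <- s) unitm j.

Lemma staircase_end_cons j s :
  staircase_end (j :: s) = unitm j + staircase_end s.
Proof. exact: big_cons. Qed.

Lemma staircase_end_cat s s' :
  staircase_end (s ++ s') = staircase_end s + staircase_end s'.
Proof. exact: big_cat. Qed.

Lemma staircase_end_rep (n : nat) s :
  staircase_end (flatten (nseq n s)) = staircase_end s *+ n.
Proof.
elim: n => [|n IH]; first by rewrite /staircase_end big_nil mulr0n.
by rewrite /= staircase_end_cat IH mulrS.
Qed.

(** All steps in one direction are taken before the next direction starts; the matrix product along
    this path is then the product of powers in the order of the theorem. *)
Definition staircase m : seq 'I_r :=
  flatten [seq nseq (m j) j | j <- index_enum 'I_r].

Lemma staircaseK m : staircase_end (staircase m) = m.
Proof.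
rewrite /staircase_end big_flatten big_map /=; apply/ffunP => i.
rewrite sum_ffunE (eq_bigr (fun j => if j == i then m i else 0)) => [|j _].
  by rewrite -big_mkcond big_pred1_eq.
rewrite big_nseq Algebra.iter_addr_0 ffunMnE ffunE eq_sym.
by have [->|] := eqVneq; [exact: natn|rewrite mul0rn].
Qed.

End MultiIndex.

(** * Words of a subshift of finite type *)

Section Subshift.
Variables (r : nat) (B : finType) (M : 'I_r -> rel B).
Implicit Types (m n l : multi r) (u v w x y : multi r -> B) (s : seq 'I_r).

(* Words of shape [m] as restrictions of total functions: the values outside
   [0, m] are junk. *)
Definition is_patch m x : Prop :=
  forall j l, mle (l + unitm j) m -> M j (x l) (x (l + unitm j)).

Definition extend_word m (w : box m -> B) : multi r -> B :=
  fun l => w (insubd (exist _ 0 (mle0m m) : {l | mle l m}) l).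

Lemma extend_wordE m (w : box m -> B) (l : box m) :
  extend_word w (sval l) = w l.
Proof.
congr w; apply: val_inj => /=; rewrite val_insubd.
by case: l => l /= ->.
Qed.

Lemma extend_word_patch m (w : box m -> B) :
  is_word M w -> is_patch m (extend_word w).
Proof.
move=> wP j l lm; have lm' := mle_trans (mle_addr l (unitm j)) lm.
have := wP j (exist _ l lm') (exist _ (l + unitm j) lm) erefl.
by rewrite -!extend_wordE.
Qed.

Lemma patch_word m x : is_patch m x -> is_word M (fun l : box m => x (sval l)).
Proof. by move=> xP j l [k km] /= kl; move: km; rewrite kl; exact: xP. Qed.

Lemma patch_mono m n x : mle m n -> is_patch n x -> is_patch m x.
Proof. by move=> mn xP j l lm; apply: xP; exact: mle_trans mn. Qed.

Lemma patch_shift p m x :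
  is_patch (p + m) x -> is_patch m (fun l => x (l + p)).
Proof.
by move=> xP j l lm; rewrite addrAC; apply: xP; rewrite addrAC addrC mle_add2l.
Qed.

Lemma sft_patch (R : realType) (x : sft M R) m : is_patch m x.
Proof. by move=> j l _; exact: sft_funP. Qed.

Lemma eq_on_edge j x y : x 0 = y 0 -> x (unitm j) = y (unitm j) ->
  forall l, mle l (unitm j) -> x l = y l.
Proof. by move=> xy0 xyj l /mle_unitm[->|->]. Qed.

(** The box of shape [unitm j] contains only 0 and [unitm j], so the same function encodes the edge
    from [a] to [b] in every direction. *)
Definition edge_patch (a b : B) : multi r -> B :=
  fun l => if l == 0 then a else b.

Lemma unitm_neq0 (j : 'I_r) : unitm j != 0 :> multi r.
Proof. by apply/eqP => /ffunP/(_ j); rewrite !ffunE eqxx. Qed.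

Lemma edge_patch0 a b : edge_patch a b 0 = a.
Proof. by rewrite /edge_patch eqxx. Qed.

Lemma edge_patch_unitm a b j : edge_patch a b (unitm j) = b.
Proof. by rewrite /edge_patch (negPf (unitm_neq0 j)). Qed.

Lemma edge_patchP j a b : M j a b -> is_patch (unitm j) (edge_patch a b).
Proof.
move=> ab i l /mle_addr_unitm[-> ->].
by rewrite add0r edge_patch0 edge_patch_unitm.
Qed.

(** * Products, extensions and existence of points under (H0)-(H2) *)

Hypothesis H0 : cond_H0 M.
Hypothesis H1 : cond_H1 M.
Hypothesis H2 : cond_H2 M.

Lemma product_exists m n u v : is_patch m u -> is_patch n v -> u m = v 0 ->
  exists w, [/\ is_patch (m + n) w, forall l, mle l m -> w l = u l
    & forall l, mle l n -> w (m + l) = v l].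
Proof.
move=> uP vP uv.
have [w [[wP [w1 w2]] _]] := H1 (patch_word uP) (patch_word vP) uv.
exists (extend_word w); split=> [|l lm|l ln]; first exact: extend_word_patch.
- have lmn := mle_trans lm (mle_addr m n).
  rewrite -[LHS]/(extend_word w (sval (exist _ l lmn : box (m + n)))).
  by rewrite extend_wordE (w1 (exist _ l lm)).
- have lmn : mle (m + l) (m + n) by rewrite mle_add2l.
  rewrite -[LHS]/(extend_word w (sval (exist _ (m + l) lmn : box (m + n)))).
  by rewrite extend_wordE (w2 (exist _ l ln)).
Qed.

(** Both words are products of the two restrictions of [w], so the uniqueness in (H1) identifies
    them. *)
Lemma product_unique m n w w' : is_patch (m + n) w -> is_patch (m + n) w' ->
  (forall l, mle l m -> w l = w' l) ->
  (forall l, mle l n -> w (l + m) = w' (l + m)) ->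
  forall l, mle l (m + n) -> w l = w' l.
Proof.
move=> wP wP' e1 e2 l lmn.
have uP := patch_mono (mle_addr m n) wP.
have vP := patch_shift wP.
have uv : w m = (fun l => w (l + m)) 0 by rewrite add0r.
have [w0 [_ wuniq]] := H1 (patch_word uP) (patch_word vP) uv.
have h := wuniq (fun k => w (sval k)); have h' := wuniq (fun k => w' (sval k)).
suff: (fun k : box (m + n) => w (sval k)) = (fun k => w' (sval k)).
  by move/(congr1 (fun f => f (exist _ l lmn))).
rewrite -h ?h' //; split; do ?exact: patch_word; split=> [[k km] [k' km'] /=|].
- by move->; rewrite e1.
- by case=> k km [k' km'] /= ->; rewrite addrC e2.
- by move->.
- by case=> k km [k' km'] /= ->; rewrite addrC.
Qed.

(** The product of the edges from [c] to [a] and from [a] to [b] is a word on the square with sides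
    [i] and [j]; its corner [unitm j] carries a [j]-successor of [c]. *)
Lemma successor_transfer i j c a : M i c a -> (exists b, M j a b) ->
  exists d, M j c d.
Proof.
move=> ca [b ab].
have [|w [wP w1 w2]] := product_exists (edge_patchP ca) (edge_patchP ab).
  by rewrite edge_patch0 edge_patch_unitm.
exists (w (unitm j)); have := wP j 0; rewrite add0r w1 ?mle0m // edge_patch0.
by apply; exact: mle_addl.
Qed.

(** (H0) supplies one letter with a [j]-successor, (H2) a directed path from [a] to it; the property
    travels back along this path. *)
Lemma successor_exists j a : exists b, M j a b.
Proof.
have [c [d cd]] := H0 j; have /connectP[p] := H2 a c.
elim: p a => [|a' p IH] a /=; first by move=> _ <-; exists d.
case/andP => /existsP[i aa'] pP lp.
exact: successor_transfer aa' (IH _ pP lp).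
Qed.

Lemma patch_exists s a : exists2 u, is_patch (staircase_end s) u & u 0 = a.
Proof.
elim: s a => [|j s IH] a.
  exists (fun=> a) => // j l; rewrite /staircase_end big_nil => /mleP/(_ j).
  by rewrite multiD !ffunE eqxx addn1.
have [b ab] := successor_exists j a; have [v vP vb] := IH b.
have [|w [wP w1 _]] := product_exists (edge_patchP ab) vP.
  by rewrite edge_patch_unitm vb.
exists w; first by rewrite staircase_end_cons.
by rewrite w1 ?mle0m // edge_patch0.
Qed.

Lemma patch_extend k u : is_patch (diag r k) u ->
  exists v, is_patch (diag r k.+1) v /\ forall l, mle l (diag r k) -> v l = u l.
Proof.
move=> uP; have [v] := patch_exists (staircase (diag r 1)) (u (diag r k)).
rewrite staircaseK => vP vu; have [|w [wP w1 _]] := product_exists uP vP => //.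
by exists w; rewrite diagS.
Qed.

(** Reading each patch at the far corner of its own box glues a coherent family into a single
    point. *)
Lemma sft_of_patches (R : realType) (U : multi r -> multi r -> B) :
  (forall m, is_patch m (U m)) ->
  (forall m n l, mle l m -> mle m n -> U n l = U m l) ->
  exists x : sft M R, forall m l, mle l m -> x l = U m l.
Proof.
move=> UP Ucoh; have xP : is_sft_point M (fun l => U l l).
  move=> m j; rewrite -(Ucoh m (m + unitm j)) ?mle_refl ?mle_addr //.
  by apply: UP; exact: mle_refl.
by exists (Sft R xP) => m l lm /=; rewrite (Ucoh l m) ?mle_refl.
Qed.

Lemma sft_point_exists (R : realType) a : exists x : sft M R, x 0 = a.
Proof.
(* A one-step extension is chosen for all pairs at once; on functions that are not patches its value
   is a dummy. *)
have /choice[F FP] : forall ku : nat * (multi r -> B), exists v,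
    is_patch (diag r ku.1) ku.2 ->
    is_patch (diag r ku.1.+1) v /\
    forall l, mle l (diag r ku.1) -> v l = ku.2 l.
  move=> [k u]; have [uP|nuP] := pselect (is_patch (diag r k) u).
    by have [v vP] := patch_extend uP; exists v.
  by exists u => /nuP.
pose U := fix U k := if k is k'.+1 then F (k', U k') else fun=> a.
have UP k : is_patch (diag r k) (U k).
  elim: k => [|k IH]; last exact: (FP (k, U k) IH).1.
  by move=> j l /mleP/(_ j); rewrite multiD !ffunE eqxx addn1.
have Ucoh k d l : mle l (diag r k) -> U (d + k)%N l = U k l.
  move=> lk; elim: d => [//|d IH]; rewrite -IH.
  apply: (FP ((d + k)%N, U (d + k)%N) (UP _)).2 => /=.
  apply: mle_trans lk _; apply/mleP => i; rewrite !ffunE; exact: leq_addl.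
(* An arbitrary box is embedded in the smallest diagonal box containing it. *)
have [||x xE] := @sft_of_patches R (fun m => U (\max_i m i)%N).
- by move=> m; apply: patch_mono (UP _); exact: mle_diag.
- move=> m n l lm /mleP mn.
  have mn' : (\max_i m i <= \max_i n i)%N.
    by apply/bigmax_leqP => i _; apply: leq_trans (mn i) _; exact: leq_bigmax.
  rewrite -(subnK mn') Ucoh //; exact: mle_trans lm (mle_diag m).
- exists x; rewrite (xE 0) ?mle_refl //; set K := (K in U K).
  by have := Ucoh 0%N K 0 (mle0m _); rewrite addn0.
Qed.

(** The edge from [a] to [y 0] is multiplied by every finite restriction of [y]; uniqueness of
    products makes these words coherent, so they glue to a point. *)
Lemma sft_prepend (R : realType) j a (y : sft M R) : M j a (y 0) ->
  exists2 x : sft M R, x 0 = a & sft_shift (unitm j) x = y.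
Proof.
move=> ay; have /choice[W WP] : forall m, exists w,
    [/\ is_patch (unitm j + m) w,
        forall l, mle l (unitm j) -> w l = edge_patch a (y 0) l
      & forall l, mle l m -> w (unitm j + l) = y l].
  move=> m; apply: product_exists; [exact: edge_patchP|exact: sft_patch|].
  by rewrite edge_patch_unitm.
have [||x xE] := @sft_of_patches R W.
- move=> m; have [mP _ _] := WP m; apply: patch_mono mP; exact: mle_addl.
- move=> m n l lm mn; have [mP m1 m2] := WP m; have [nP n1 n2] := WP n.
  have mn' : mle (unitm j + m) (unitm j + n) by rewrite mle_add2l.
  apply: (product_unique (patch_mono mn' nP) mP) => [k kj|k km|].
  + by rewrite n1 // m1.
  + by rewrite addrC n2 ?m2 //; exact: mle_trans mn.
  + exact: mle_trans lm (mle_addl _ _).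
- exists x.
    have [_ + _] := WP 0; rewrite (xE 0) ?mle_refl // => ->; last exact: mle0m.
    exact: edge_patch0.
  case: x xE => x xP /= xE; case: y ay WP => y yP /= ay WP.
  have e : (fun m => x (m + unitm j)) = y.
    apply/funext => m; rewrite (xE (unitm j + m)); last by rewrite addrC mle_refl.
    rewrite [m + _]addrC; have [_ _] := WP (unitm j + m); apply; exact: mle_addl.
  by rewrite /sft_shift; move: (sft_shift_is_sft_point _ _) => /=;
    rewrite e => yP'; congr Sft; exact: Prop_irrelevance.
Qed.

(** * Coding words by their letters along a staircase *)

Fixpoint lattice_words s (a : B) : seq (seq B) :=
  if s is j :: s' then
    [seq b :: t | b <- [seq b <- enum B | M j a b], t <- lattice_words s' b]
  else [:: [::]].

Fixpoint trace s x : seq B :=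
  if s is j :: s' then x (unitm j) :: trace s' (fun l => x (l + unitm j))
  else [::].

Lemma trace_lattice_words s x :
  is_patch (staircase_end s) x -> trace s x \in lattice_words s (x 0).
Proof.
elim: s x => [|j s IH] x //; rewrite staircase_end_cons => xP /=.
apply/allpairsPdep; exists (x (unitm j)), (trace s (fun l => x (l + unitm j))).
split=> //; first rewrite mem_filter mem_enum andbT.
  by have := xP j 0; rewrite add0r; apply; exact: mle_addr.
by have := IH _ (patch_shift xP); rewrite /= add0r.
Qed.

(** The word is a product of its first edge and the rest; the uniqueness in (H1) recovers it from
    these, and the rest is determined by induction. *)
Lemma trace_inj s x y :
  is_patch (staircase_end s) x -> is_patch (staircase_end s) y ->
  x 0 = y 0 -> trace s x = trace s y ->
  forall l, mle l (staircase_end s) -> x l = y l.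
Proof.
elim: s x y => [|j s IH] x y.
  rewrite /staircase_end big_nil => _ _ xy0 _ l l0; suff -> : l = 0 by [].
  by apply/ffunP => i; move/mleP/(_ i): l0; rewrite !ffunE leqn0 => /eqP.
rewrite staircase_end_cons => xP yP xy0 [xyj xyt].
apply: product_unique => //; first exact: eq_on_edge.
by apply: IH (patch_shift xP) (patch_shift yP) _ xyt; rewrite !add0r.
Qed.

Lemma eq_trace s x y :
  (forall l, mle l (staircase_end s) -> x l = y l) -> trace s x = trace s y.
Proof.
elim: s x y => [|j s IH] x y //; rewrite staircase_end_cons => xy /=.
rewrite xy ?mle_addr //; congr cons; apply: IH => l ls.
by rewrite xy // addrC mle_add2l.
Qed.

Lemma trace_cat s s' x :
  trace (s ++ s') x = trace s x ++ trace s' (fun l => x (l + staircase_end s)).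
Proof.
elim: s x => [|j s IH] x /=; rewrite /staircase_end ?big_nil ?big_cons.
  by congr trace; apply/funext => l; rewrite addr0.
rewrite IH; congr (_ :: _ ++ trace _ _); apply/funext => l.
by rewrite -addrA [_ + unitm j]addrC.
Qed.

(** The point is built from the far end: start with any point at the last letter and prepend the
    edges of the staircase backwards. *)
Lemma lattice_words_realised (R : realType) s a t : t \in lattice_words s a ->
  exists2 x : sft M R, x 0 = a & trace s x = t.
Proof.
elim: s a t => [|j s IH] a t /=.
  by rewrite inE => /eqP ->; have [x xa] := sft_point_exists R a; exists x.
case/allpairsPdep => b [w' [+ + ->]]; rewrite mem_filter => /andP[ab _] /IH[y yb yw].
have [|x xa xy] := @sft_prepend R j a y; first by rewrite yb.
exists x => //; rewrite -yw -yb -xy /=; congr cons.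
by rewrite /= add0r.
Qed.

Lemma uniq_lattice_words s a : uniq (lattice_words s a).
Proof.
elim: s a => //= j s IH a; apply: allpairs_uniq_dep => //.
  by rewrite filter_uniq // enum_uniq.
by move=> [b w] [b' w'] _ _ /= [-> ->].
Qed.

(** Adding the letter at the origin makes the code complete: codes correspond to words of shape
    [staircase_end s]. *)
Definition path_codes s : seq (seq B) :=
  [seq a :: t | a <- enum B, t <- lattice_words s a].

Definition path_code s x : seq B := x 0 :: trace s x.

Lemma uniq_path_codes s : uniq (path_codes s).
Proof.
apply: allpairs_uniq_dep => [|a _|]; rewrite ?enum_uniq ?uniq_lattice_words //.
by move=> [b w] [b' w'] _ _ /= [-> ->].
Qed.

Lemma mem_path_codes s x :
  is_patch (staircase_end s) x -> path_code s x \in path_codes s.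
Proof.
move=> xP; apply/allpairsPdep; exists (x 0), (trace s x).
by rewrite mem_enum trace_lattice_words.
Qed.

Lemma path_codes_realised (R : realType) s t : t \in path_codes s ->
  exists x : sft M R, path_code s x = t.
Proof.
case/allpairsPdep => a [w' [_ /(lattice_words_realised R)[x xa xw] ->]].
by exists x; rewrite /path_code xa xw.
Qed.

(** * Counting codes by matrix products *)

Section Counting.
Variable R : realType.
Local Notation A s := (\prod_(j <- s) sft_matrix M R j).

Lemma sft_matrix_ge0 j i k : 0 <= sft_matrix M R j i k.
Proof. by rewrite mxE ler0n. Qed.

Lemma staircase_matrix_ge0 s i k : 0 <= (A s) i k.
Proof.
elim: s i k => [|j s IH] i k; first by rewrite big_nil mxE; case: eqP.
rewrite big_cons mxE; apply: sumr_ge0 => l _.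
by rewrite mulr_ge0 // sft_matrix_ge0.
Qed.

(** Expanding the first factor of the product amounts to choosing the first letter of the walk; the
    identity matrix counts the empty walk. *)
Lemma size_lattice_words s i :
  \sum_k (A s) i k = (size (lattice_words s (enum_val i)))%:R.
Proof.
elim: s i => [|j s IH] i.
  rewrite big_nil (bigD1 i) //= big1 ?addr0 => [|k ki]; rewrite mxE ?eqxx //.
  by rewrite eq_sym (negPf ki).
rewrite big_cons /= size_allpairs_dep sumnE big_map big_filter natr_sum.
under eq_bigr => k _ do rewrite mxE.
rewrite exchange_big /= big_enum_cond /= [RHS]big_mkcond /=.
rewrite [RHS](reindex (@enum_val B predT)) /=; last exact/onW_bij/enum_val_bij.
apply: eq_bigr => l _; rewrite -mulr_sumr IH mxE.
by case: (M _ _ _); rewrite ?mul1r ?mul0r.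
Qed.

Lemma size_path_codes s :
  \sum_i \sum_k `|(A s) i k| = (size (path_codes s))%:R.
Proof.
rewrite size_allpairs_dep sumnE big_map natr_sum big_enum /=.
rewrite (reindex (@enum_val B predT)) /=; last exact/onW_bij/enum_val_bij.
apply: eq_bigr => i _; rewrite -size_lattice_words.
by apply: eq_bigr => k _; rewrite ger0_norm ?staircase_matrix_ge0.
Qed.

End Counting.

End Subshift.

(** * Entropy of the shifts *)

Section Limsup.
Variable R : realType.

Lemma limn_esup_le_inv (u : nat -> \bar R) (c l : R) : 0 <= c ->
  (forall n, (0 < n)%N -> (u n <= (c / n%:R + l)%:E)%E) ->
  (limn_esup u <= l%:E)%E.
Proof.
move=> c0 H; apply/lee_addgt0Pr => e e0; apply: ge_ereal_inf.
(* From this index on [c / n <= e]; the successor also keeps [n] positive. *)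
pose N := (Num.trunc (c / e)).+1.
exists (ereal_sup [set u n | n in [set n | (N <= n)%N]]).
  by exists [set n | (N <= n)%N] => //; exact: nbhs_infty_ge.
apply: ge_ereal_sup => _ [n /= Nn <-].
have n0 : (0 < n)%N by apply: leq_trans Nn.
apply: le_trans (H n n0) _; rewrite -EFinD lee_fin addrC lerD2l.
rewrite ler_pdivrMr ?ltr0n // mulrC -ler_pdivrMr //.
by apply: (le_trans (ltW (truncnS_gt _))); rewrite ler_nat.
Qed.

Lemma limn_esup_ge (u : nat -> \bar R) (l : \bar R) :
  (forall n, (0 < n)%N -> (l <= u n)%E) -> (l <= limn_esup u)%E.
Proof.
move=> H; apply: le_ereal_inf_tmp => _ [V [N _ NV] <-].
(* Every tail contains a positive index, so nothing is needed at [n = 0], where the normalising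
   factor [n^-1] is 0. *)
apply: le_trans (H N.+1 isT) _; apply: ereal_sup_ubound.
by exists N.+1 => //; apply: NV => /=.
Qed.

End Limsup.

(** * Separated sets and first-difference distances *)

Section Separated.
Variables (R : realType) (X : metricType R).
Implicit Types (D : X -> X -> R) (eps K : R).

Lemma log_max_separated_ge0 D eps : (0 <= log_max_separated D eps)%E.
Proof. by rewrite lne_ge0 le_max lexx. Qed.

Lemma log_max_separated_le D eps K : 1 <= K ->
  (forall E : {fset X}, eps_separated D eps E -> #|` E|%:R <= K) ->
  (log_max_separated D eps <= (ln K)%:E)%E.
Proof.
move=> K1 H; have K0 := lt_le_trans ltr01 K1; rewrite -lne_EFin // lee_lne.
- rewrite ge_max lee_fin K1; apply: ge_ereal_sup => _ [E /H EK <-].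
  by rewrite lee_fin.
- by rewrite in_itv /= leey andbT le_max lee_fin ler01.
- by rewrite in_itv /= leey andbT lee_fin ltW.
Qed.

Lemma log_max_separated_ge D eps K (E : {fset X}) : 0 < K ->
  eps_separated D eps E -> K <= #|` E|%:R ->
  ((ln K)%:E <= log_max_separated D eps)%E.
Proof.
move=> K0 EP KE; rewrite -lne_EFin // lee_lne.
- rewrite le_max; apply/orP; right.
  apply: (@le_trans _ _ (#|` E|%:R)%:E); first by rewrite lee_fin.
  by apply: ereal_sup_ubound; exists E.
- by rewrite in_itv /= leey andbT lee_fin ltW.
- by rewrite in_itv /= leey andbT le_max lee_fin ler01.
Qed.

Lemma bowen_dist_gtP (f : X -> X) n x y eps : 0 < eps ->
  reflect (exists2 i, (i < n)%N & eps < mdist (iter i f x) (iter i f y))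
          (eps < bowen_dist f n x y).
Proof.
move=> e0; apply: (iffP (bigmax_gtP _ _ _ _)).
  case=> [/(lt_trans e0)|[i _ h]]; first by rewrite ltxx.
  by exists (val i); [exact: ltn_ord|exact: h].
by case=> i i_n h; right; exists (Ordinal i_n).
Qed.

End Separated.

(** Take [k] with [1 / (k + 1) < eps]: a distance above [eps] puts the first difference before [k],
    and by monotonicity a difference persists at all later indices. *)
Lemma first_diff_dist_gt (R : realType) (X : Type) (Y : nat -> Type)
    (res : forall j, X -> Y j) (eps : R) :
  (forall j k x y, (j <= k)%N -> res k x = res k y -> res j x = res j y) ->
  0 < eps ->
  exists k, forall x y, eps < first_diff_dist R res x y -> res k x <> res k y.
Proof.
move=> resP e0; have [k] := ltr_add_invr e0; rewrite add0r => ke.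
exists k => x y + exy.
rewrite /first_diff_dist; case: pselect => [h|_]; last first.
  by move/(lt_trans e0); rewrite ltxx.
case: ex_minnP => j /asboolP xyj _; rewrite ltNge => /negP; apply.
apply: le_trans (ltW ke); rewrite lef_pV2 ?posrE ?ltr0n // ler_nat ltnS leqNgt.
by apply/negP => jk; apply: xyj; exact: resP (ltnW jk) exy.
Qed.

(** * Entropy of a single shift of a subshift of finite type *)

Section SubshiftEntropy.
Variables (R : realType) (r : nat) (B : finType) (M : 'I_r -> rel B).
Hypothesis hr : (0 < r)%N.
Hypothesis H0 : cond_H0 M.
Hypothesis H1 : cond_H1 M.
Hypothesis H2 : cond_H2 M.
Local Notation X := (sft M R).
Implicit Types (x y : X) (s : seq 'I_r) (p : multi r).

Lemma iter_sft_shift p i x l : iter i (sft_shift p) x l = x (l + p *+ i).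
Proof.
elim: i l => [|i IH] l; first by rewrite mulr0n addr0.
by rewrite iterS /= IH -addrA mulrS.
Qed.

Lemma sft_dist_gt (eps : R) : 0 < eps -> exists k, forall x y,
  eps < mdist x y -> exists2 l, mle l (diag r k) & x l <> y l.
Proof.
case/(@first_diff_dist_gt _ X _ (fun j => @sft_restr r B M R (diag r j))).
  move=> j k x y jk e; apply/funext => -[l lj].
  exact: (congr1 (fun f => f (exist _ l (mle_trans lj (diag_mono r jk)))) e).
move=> k kP; exists k => x y /kP xy; apply: contrapT => h; apply: xy.
by apply/funext => -[l lk]; apply: contrapT => xyl; apply: h; exists l.
Qed.

Lemma sft_dist_lb k l x y : mle l (diag r k) -> x l <> y l ->
  k.+1%:R^-1 <= mdist x y.
Proof.
move=> lk xy; apply: first_diff_dist_lb => e; apply: xy.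
exact: (congr1 (fun f => f (exist _ l lk)) e).
Qed.

(** The [i]-th copy of [s] in the repeated staircase is read by the [i]-th iterate inside the box of
    [s]. *)
Lemma trace_rep_eq n s x y :
  (forall i, (i < n)%N -> forall l, mle l (staircase_end s) ->
     iter i (sft_shift (staircase_end s)) x l =
     iter i (sft_shift (staircase_end s)) y l) ->
  trace (flatten (nseq n s)) x = trace (flatten (nseq n s)) y.
Proof.
elim: n x y => [|n IH] x y H //=.
rewrite !trace_cat; congr cat; first exact: eq_trace (H 0%N isT).
apply: (IH (sft_shift _ x) (sft_shift _ y)) => i i_n l ls.
by rewrite -!iterSr; exact: H.
Qed.

Lemma card_le_path_codes s (E : {fset X}) :
  {in E &, injective (fun x => path_code s x)} ->
  (#|` E| <= size (path_codes M s))%N.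
Proof.
move=> inj; rewrite cardfE cardE -(size_map (fun x : E => path_code s (val x))).
apply: uniq_leq_size.
  rewrite map_inj_uniq ?enum_uniq // => x y /inj e.
  by apply: val_inj; apply: e; exact: valP.
move=> _ /mapP[x _ ->]; exact/mem_path_codes/sft_patch.
Qed.

(** One point is taken per code. Different codes force some iterate to differ inside the box of
    shape [p], hence at distance at least [1 / (max p + 1)]; the [.+2] makes the separation
    strict. *)
Lemma path_codes_separated p n : (0 < n)%N ->
  exists2 E : {fset X},
    eps_separated (bowen_dist (sft_shift p) n) (\max_i p i).+2%:R^-1 E &
    #|` E| = size (path_codes M (flatten (nseq n (staircase p)))).
Proof.
move=> n0; set s := flatten _; set k := (\max_i p i)%N.
have /choice[g gP] : forall t, exists x : X,
    t \in path_codes M s -> path_code s x = t.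
  move=> t; have [/(path_codes_realised H0 H1 H2 R)[x <-]|_] := boolP (_ \in _).
    by exists x.
  have [a _] := H0 (Ordinal hr).
  by have [x _] := sft_point_exists H0 H1 H2 R a; exists x.
exists [fset x in map g (path_codes M s)]%fset; last first.
  rewrite card_fseq undup_id ?size_map // map_inj_in_uniq ?uniq_path_codes //.
  by move=> t t' /gP {2}<- /gP {2}<- ->.
move=> x y; rewrite !inE => /mapP[t ts ->] /mapP[t' ts' ->] tt'.
apply/bowen_dist_gtP; first by rewrite invr_gt0 ltr0n.
apply: contrapT => h; move/eqP: tt'; apply.
have agree i : (i < n)%N -> forall l, mle l (staircase_end (staircase p)) ->
    iter i (sft_shift (staircase_end (staircase p))) (g t) l =
    iter i (sft_shift (staircase_end (staircase p))) (g t') l.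
  rewrite staircaseK => i_n l lp; apply: contrapT => ne; apply: h; exists i => //.
  apply: lt_le_trans (sft_dist_lb (mle_trans lp (mle_diag p)) ne).
  by rewrite ltf_pV2 ?posrE ?ltr0n // ltr_nat.
congr g; rewrite -(gP t) // -(gP t') // /path_code (trace_rep_eq agree).
(* The letter at the origin is seen by iterate 0, which exists because [n] is positive. *)
by congr cons; exact: (agree 0%N n0 0 (mle0m _)).
Qed.

(** Separated points differ at some [l + i p] with [i < n] and [l] in the box of side [k]. This
    position lies below [n p + (k, ..., k)], so the codes along a staircase to that corner
    differ. *)
Lemma separated_le_path_codes p (eps : R) : 0 < eps ->
  exists k, forall n (E : {fset X}),
    eps_separated (bowen_dist (sft_shift p) n) eps E ->
    (#|` E| <= size (path_codes M
       (flatten (nseq n (staircase p)) ++ staircase (diag r k))))%N.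
Proof.
move=> e0; have [k kP] := sft_dist_gt e0; exists k => n E EP.
apply: card_le_path_codes => x y xE yE [xy0 xyt].
apply/eqP; apply: contrapT => /negP xy.
have /(bowen_dist_gtP _ _ _ _ e0)[i i_n /kP[l lk]] := EP x y xE yE xy.
rewrite !iter_sft_shift; apply; apply: (trace_inj H1 _ _ xy0 xyt).
- exact: sft_patch.
- exact: sft_patch.
- rewrite staircase_end_cat staircase_end_rep !staircaseK [X in mle _ X]addrC.
  apply: mle_trans (mle_add _ lk) _; rewrite mle_add2l.
  by rewrite -(subnK (ltnW i_n)) mulrnDr mle_addl.
Qed.

Local Notation A p := (\prod_(j < r) sft_matrix M R j ^+ p j).

Lemma staircase_matrix p : \prod_(j <- staircase p) sft_matrix M R j = A p.
Proof.
rewrite big_flatten big_map /=; apply: eq_bigr => j _.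
by rewrite big_nseq iter_mulr_1.
Qed.

Lemma staircase_matrix_rep p n s :
  \prod_(j <- flatten (nseq n (staircase p)) ++ s) sft_matrix M R j =
  A p ^+ n * \prod_(j <- s) sft_matrix M R j.
Proof.
elim: n => [|n IH]; first by rewrite mul1r.
by rewrite /= -catA big_cat /= IH staircase_matrix exprS mulrA.
Qed.

Lemma card_letters_gt0 : (0 < #|B|)%N.
Proof. by have [a _] := H0 (Ordinal hr); apply/card_gt0P; exists a. Qed.

Lemma size_path_codes_growth p s (rho : R) : spectral_radius (A p) < rho ->
  exists2 C : R, 0 <= C & forall n,
    (size (path_codes M (flatten (nseq n (staircase p)) ++ s)))%:R
      <= C * rho ^+ n.
Proof.
move=> /(spectral_radius_growth (\prod_(j <- s) sft_matrix M R j) card_letters_gt0).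
move=> [C C0 H]; exists (C *+ #|B| *+ #|B|) => [|n]; first by rewrite !mulrn_wge0.
rewrite -lecR rmorph_nat -size_path_codes staircase_matrix_rep.
apply: (@le_trans _ _ (\sum_(i < #|B|) \sum_(k < #|B|) (C * rho ^+ n)%:C%C)).
  by apply: ler_sum => i _; apply: ler_sum => k _; exact: H.
by rewrite !sumr_const !card_ord !mulrnAl !rmorphMn.
Qed.

Lemma spectral_radius_le_size_path_codes p n :
  spectral_radius (A p) ^+ n <=
    (size (path_codes M (flatten (nseq n (staircase p)))))%:R.
Proof.
rewrite -lecR rmorph_nat -size_path_codes -[flatten _]cats0.
rewrite staircase_matrix_rep big_nil mulr1 spectral_radius_power_le //.
exact: card_letters_gt0.
Qed.

(** Otherwise the number of codes of length-[n] repetitions would tend to 0, while a point of the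
    subshift always provides at least one code. *)
Lemma spectral_radius_ge1 p : 1 <= spectral_radius (A p).
Proof.
rewrite leNgt; apply/negP => r1.
have [rho /andP[r_rho rho1]] : exists rho, spectral_radius (A p) < rho < 1.
  by exists ((spectral_radius (A p) + 1) / 2); rewrite !(midf_lt r1).
have rho0 : 0 < rho.
  apply: le_lt_trans r_rho; have [l [_ -> _]] :=
    spectral_radius_attained (A p) card_letters_gt0.
  by case: l => a b; exact: sqrtr_ge0.
have [C C0 H] := size_path_codes_growth [::] r_rho.
have : geometric C rho @ \oo --> 0.
  by apply: cvg_geometric; rewrite gtr0_norm.
move=> /cvgrPdist_lt/(_ 1 ltr01)[N _ /(_ N (leqnn N))] /=.
rewrite sub0r normrN ger0_norm; last by rewrite mulr_ge0 // exprn_ge0 // ltW.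
rewrite ltNge => /negP; apply; apply: le_trans (H N).
rewrite ler1n; set s := _ ++ _; have [a _] := H0 (Ordinal hr).
have [x _] := sft_point_exists H0 H1 H2 R a.
have := mem_path_codes (sft_patch x (m := staircase_end s)).
by case: (path_codes M s).
Qed.

Lemma sft_entropy_le p : (entropy (@sft_shift r B M R p) <=
  (ln (spectral_radius (A p)))%:E)%E.
Proof.
have r1 := spectral_radius_ge1 p; have r0 := lt_le_trans ltr01 r1.
apply: ge_ereal_sup => _ [eps /= e0 <-].
have [k kP] := separated_le_path_codes p e0.
(* The growth bound needs a strictly larger rate; the factor [expR d] adds exactly [d] to the
   logarithm. *)
apply/lee_addgt0Pr => d d0; set rho := spectral_radius (A p) * expR d.
have r_rho : spectral_radius (A p) < rho by rewrite ltr_pMr // expR_gt1.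
have rho1 : 1 <= rho by apply: le_trans (ltW r_rho).
have [C C0 H] := size_path_codes_growth (staircase (diag r k)) r_rho.
rewrite -EFinD -[d]expRK -lnM ?posrE ?expR_gt0 // -/rho.
(* Replacing [C] by [C + 1] keeps the bound at least 1, which absorbs the maximum with 1 in
   [log_max_separated]. *)
have C1 : 1 <= C + 1 by rewrite lerDr.
have K1 n : 1 <= (C + 1) * rho ^+ n by rewrite mulr_ege1 // exprn_ege1.
apply: (@limn_esup_le_inv _ _ (ln (C + 1))) => [|n n0]; first exact: ln_ge0.
have n0' : 0 < n%:R :> R by rewrite ltr0n.
apply: (@le_trans _ _ ((n%:R^-1)%:E * (ln ((C + 1) * rho ^+ n))%:E)%E).
  apply: lee_wpmul2l; first by rewrite lee_fin invr_ge0 ler0n.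
  apply: log_max_separated_le (K1 n) _ => E EP.
  apply: (@le_trans _ _ (C * rho ^+ n)).
    by apply: le_trans (H n); rewrite ler_nat; exact: kP.
  by rewrite ler_wpM2r ?lerDl // exprn_ge0 // (le_trans ler01).
rewrite -EFinM lee_fin lnM ?posrE ?exprn_gt0 ?(lt_le_trans ltr01) //.
rewrite lnXn ?(lt_le_trans ltr01) // mulrDr [_ * ln (C + 1)]mulrC.
by rewrite -[ln _ *+ n]mulr_natl mulKf // gt_eqF.
Qed.

Lemma sft_entropy_ge p : ((ln (spectral_radius (A p)))%:E <=
  entropy (@sft_shift r B M R p))%E.
Proof.
have r1 := spectral_radius_ge1 p; have r0 := lt_le_trans ltr01 r1.
(* This scale does not depend on [n], so it alone bounds the supremum from below, and the estimate
   holds at every positive [n]. *)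
pose eps : R := (\max_i p i).+2%:R^-1.
apply: (@le_trans _ _ (limn_esup (fun n : nat => ((n%:R^-1)%:E *
  log_max_separated (bowen_dist (@sft_shift r B M R p) n) eps)%E))); last first.
  by apply: ereal_sup_ubound; exists eps => //=; rewrite invr_gt0 ltr0n.
apply: limn_esup_ge => n n0; have [E EP EE] := path_codes_separated p n0.
have n0' : 0 < n%:R :> R by rewrite ltr0n.
apply: (@le_trans _ _ ((n%:R^-1)%:E * (ln (spectral_radius (A p) ^+ n))%:E)%E).
  by rewrite -EFinM lee_fin lnXn // -[ln _ *+ n]mulr_natl mulKf // gt_eqF.
apply: lee_wpmul2l; first by rewrite lee_fin invr_ge0 ler0n.
apply: log_max_separated_ge EP _; first exact: exprn_gt0.
by rewrite EE spectral_radius_le_size_path_codes.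
Qed.

End SubshiftEntropy.

(** * Entropy of the action on the path space of a rank-r graph *)

Section RankGraphEntropy.
Variables (R : realType) (r : nat) (L : rank_graph r).
Local Notation X := (path_space L R).
Implicit Types (x y : X) (m n k : multi r).

Lemma path_factors_eq x y m k n (mk : mle m k) (kn : mle k n) (mn : mle m n) :
  x m n mn = y m n mn -> x m k mk = y m k mk /\ x k n kn = y k n kn.
Proof.
have [xs xm] := path_wordP x; have [ys ym] := path_wordP y.
have [xt xE] := xm _ _ _ mk kn mn; have [yt yE] := ym _ _ _ mk kn mn.
by rewrite xE yE; apply: mulw_inj; rewrite // ?xs ?ys.
Qed.

Lemma path_prefix_eq x y N m n (mn : mle m n) : mle n N ->
  path_prefix N x = path_prefix N y -> x m n mn = y m n mn.
Proof.
move=> nN /(path_factors_eq (mle0m m) (mle_trans mn nN))[_].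
by case/(path_factors_eq mn nN).
Qed.

Lemma diagS_ge j : mle (diag r j) (diag r j.+1).
Proof. exact: diag_mono. Qed.

Definition diag_step j x : word L := x _ _ (diagS_ge j).

Lemma diag_steps_prefix K x y :
  (forall j, (j <= K)%N -> diag_step j x = diag_step j y) ->
  path_prefix (diag r K.+1) x = path_prefix (diag r K.+1) y.
Proof.
have [xs xm] := path_wordP x; have [ys ym] := path_wordP y.
elim: K => [|K IH] H.
  have e0 : diag r 0 = 0 by apply/ffunP => i; rewrite !ffunE.
  have := H 0%N isT; rewrite /diag_step /path_prefix.
  move: (diagS_ge 0) (mle0m (diag r 1)); rewrite e0 => p q.
  by rewrite (bool_irrelevance p q).
rewrite /path_prefix; have [_ ->] := xm _ _ _ (mle0m _) (diagS_ge K.+1) (mle0m _).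
have [_ ->] := ym _ _ _ (mle0m _) (diagS_ge K.+1) (mle0m _).
congr mulw; last exact: H.
by apply: IH => j jK; apply: H; exact: leqW.
Qed.

(** Finitely many objects and row finiteness leave finitely many words of shape (1, ..., 1), so a
    single finite alphabet codes every diagonal step. *)
Lemma diag_step_code : row_finite L -> finite_set [set: obj L] ->
  exists (N : nat) (g : word L -> 'I_N.+1),
    forall j x y, g (diag_step j x) = g (diag_step j y) ->
    diag_step j x = diag_step j y.
Proof.
move=> rf ofin; pose F := \bigcup_a words_from (diag r 1) (a : obj L).
have FF x j : F (diag_step j x).
  exists (org (diag_step j x)) => //; split=> //.
  have [xs _] := path_wordP x; rewrite /diag_step xs.
  by apply/ffunP => i; rewrite !ffunE subSnn.
have /finite_setP[N /card_eqPle[/pcard_leP[f] _]] : finite_set F.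
  by apply: bigcup_finite => // a _; exact: rf.
exists N, (fun w => inord (f w)) => j x y /(congr1 val) /=.
have fN w : F w -> (f w < N.+1)%N.
  by move=> Fw; apply: ltnW; rewrite ltnS; exact: (@funS _ _ _ _ f).
rewrite !inordK ?fN //; apply: inj; rewrite inE; exact: FF.
Qed.

Lemma path_dist_gt (eps : R) : 0 < eps -> exists k : nat, forall x y,
  eps < mdist x y -> path_prefix (diag r k) x <> path_prefix (diag r k) y.
Proof.
case/(@first_diff_dist_gt _ X _ (fun j => @path_prefix r L R (diag r j))).
  by move=> j k x y jk; apply: path_prefix_eq; exact: diag_mono.
by move=> k kP; exists k => x y /kP.
Qed.

(** Separation by a shift [a <= (n, ..., n)] is visible in the prefix of shape
    [(n + k + 1, ..., n + k + 1)], which is determined by its [n + k + 1] diagonal steps. *)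
Lemma path_separated_le (eps : R) : row_finite L -> finite_set [set: obj L] ->
  0 < eps -> exists N k : nat, forall (n : nat) (E : {fset X}),
    eps_separated (action_dist (@path_shift r L R) n) eps E ->
    (#|` E| <= N.+1 ^ (n + k).+1)%N.
Proof.
move=> rf ofin e0; have [N [g gP]] := diag_step_code rf ofin.
have [k kP] := path_dist_gt e0; exists N, k => n E EP.
pose code (x : X) := [ffun j : 'I_(n + k).+1 => g (diag_step j x)].
have -> : (N.+1 ^ (n + k).+1 = #|{ffun 'I_(n + k).+1 -> 'I_N.+1}|)%N.
  by rewrite card_ffun !card_ord.
rewrite cardfE; apply: (@leq_card _ _ (fun x : E => code (val x))).
move=> x y xy; apply: val_inj; apply/eqP; apply: contrapT => /negP ne.
have /bigmax_gtP[/(lt_trans e0)|[a _ /kP]] := EP _ _ (valP x) (valP y) ne.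
  by rewrite ltxx.
apply; apply: (@path_prefix_eq (val x) (val y) (diag r (n + k).+1)).
  apply/mleP => i; rewrite multiD !ffunE addnC; apply: leqW.
  by rewrite leq_add2r -ltnS.
apply: diag_steps_prefix => j jn; apply: gP.
by move/ffunP/(_ (Ordinal (jn : (j < (n + k).+1)%N))): xy; rewrite !ffunE.
Qed.

Lemma path_action_entropy0 : (2 <= r)%N -> row_finite L ->
  finite_set [set: obj L] -> action_entropy (@path_shift r L R) = 0%E.
Proof.
move=> r2 rf ofin; apply/eqP; rewrite eq_le; apply/andP; split; last first.
  (* Any scale gives the lower bound, since [log_max_separated] is never negative. *)
  apply: (@le_trans _ _ (limn_esup (fun n : nat => (((n ^ r)%:R^-1)%:E *
    log_max_separated (action_dist (@path_shift r L R) n) 1)%E))).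
    apply: limn_esup_ge => n _; apply: mule_ge0; last exact: log_max_separated_ge0.
    by rewrite lee_fin invr_ge0 ler0n.
  by apply: ereal_sup_ubound; exists 1 => //=.
apply: ge_ereal_sup => _ [eps /= e0 <-].
have [N [k NkP]] := path_separated_le rf ofin e0.
have N1 : 1 <= N.+1%:R :> R by rewrite ler1n.
have lnN : 0 <= ln (N.+1%:R) :> R by rewrite ln_ge0.
apply: (@limn_esup_le_inv _ _ (k.+2%:R * ln N.+1%:R)) => [|n n0].
  by rewrite mulr_ge0.
have n0' : 0 < n%:R :> R by rewrite ltr0n.
apply: (@le_trans _ _ (((n ^ r)%:R^-1)%:E * (ln (N.+1%:R ^+ (n + k).+1))%:E)%E).
  apply: lee_wpmul2l; first by rewrite lee_fin invr_ge0 ler0n.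
  apply: log_max_separated_le; first by rewrite exprn_ege1.
  by move=> E /NkP; rewrite -natrX ler_nat.
rewrite -EFinM lee_fin addr0 lnXn ?ltr0n // -[ln _ *+ _]mulr_natl mulrA.
rewrite [leRHS]mulrAC ler_wpM2r // ler_pdivlMr // [_^-1 * _]mulrC mulrAC.
rewrite ler_pdivrMr ?ltr0n ?expn_gt0 ?n0 // -!natrM ler_nat.
(* For [n >= 1] one has [n + k + 1 <= (k + 2) n]; then [n * n <= n ^ r] is where [r >= 2] enters,
   leaving a bound of order [1 / n]. *)
apply: (@leq_trans ((k.+2 * n) * n)).
  rewrite leq_mul2r; apply/orP; right.
  by rewrite -addnS mulSn leq_add2l leq_pmulr.
by rewrite -mulnA leq_mul2l mulnn leq_pexp2l ?orbT.
Qed.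

End RankGraphEntropy.

Theorem proposition1p2 (R : realType) (r : nat) (hr : (1 <= r)%N) :
  (forall (B : finType) (M : 'I_r -> rel B),
     cond_H0 M -> cond_H1 M -> cond_H2 M -> cond_H3 M ->
     forall p : multi r,
       entropy (@sft_shift r B M R p) =
       (ln (spectral_radius (\prod_(j < r) sft_matrix M R j ^+ p j)))%:E)
  /\
  ((2 <= r)%N ->
   forall L : rank_graph r,
     row_finite L -> no_sources L -> finite_set [set: obj L] ->
     action_entropy (@path_shift r L R) = 0%E).
Proof.
split=> [B M h0 h1 h2 _ p|r2 L rf _ ofin]; last exact: path_action_entropy0.
by apply/eqP; rewrite eq_le sft_entropy_le // sft_entropy_ge.
Qed.
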